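(* Let $f\in B^{b,+}_\infty$. Then there exists $s_0>-\infty$ and a measurable function, unique except on a set of Lebesgue measure zero, $s\mapsto f_s\in[-1,1]\setminus\{0\}$, for $s>s_0$, such that $f_s\smile f_t=f_s$ for $s\le t$ and $$f=\int_{s_0}^\infty[f_s]\,e^{-s}\,ds.$$
   Context: For $x\in[-1,1]$, $[x]$ denotes the function of $z>0$ given by $[x](z)=\mathrm{sign}(x)|x|^z$ (and $[0]=0$); integrals of such functions are taken pointwise in $z$, so the displayed equality means $f(z)=\int_{s_0}^\infty[f_s](z)\,e^{-s}\,ds$ for all $z>0$. The symbol $\smile$ denotes the hyperaddition of the real tropical hyperfield on $\mathbb R$: $a\smile b=a$ if $|a|>|b|$ or $a=b$; $a\smile b=b$ if $|a|<|b|$ or $a=b$; and $a\smile b$ is the closed interval between $-a$ and $a$ if $b=-a$. Thus, for $a,b\in\mathbb R$, $a\smile b=a$ if and only if $|a|\ge|b|$, and $a=b$ in case $|a|=|b|$. $B^{b,+}_\infty$ is the space of real functions of $z>0$ of the form $\int_0^V[x_u]\,du$, where $V<\infty$ and $u\mapsto x_u\in[-1,1]$ is a measurable function of $u\in[0,V]$ such that $x_u\smile x_v=x_u$ for $u\le v$. Equivalently, it is the space of functions $f(z)=\int_0^\infty e^{-\xi z}d\mu(\xi)$ with $\mu$ a finite real Borel measure on $[0,\infty)$. *)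

(* Defs.v *)
From HB Require Import structures.
From mathcomp Require Import all_boot all_order all_algebra.
From mathcomp Require Import all_classical all_reals all_analysis.

Set Implicit Arguments.
Unset Strict Implicit.
Unset Printing Implicit Defensive.

Import Order.TTheory GRing.Theory Num.Theory.
Import numFieldNormedType.Exports.

Local Open Scope classical_set_scope.
Local Open Scope ring_scope.

(* The hypersum is set-valued, so "a \smile b = a" is read as
   [hyperadd a b = [set a]]. The last branch is the case b = - a <> 0. *)
Definition hyperadd (R : realType) (a b : R) : set R :=
  if (`|b| < `|a|) || (a == b) then [set a]
  else if `|a| < `|b| then [set b]
  else [set c | - `|a| <= c <= `|a|].

Definition bracket (R : realType) (x z : R) : R := Num.sg x * `|x| `^ z.

Definition nested_on (R : realType) (D : set R) (x : R -> R) : Prop :=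
  forall u v : R, D u -> D v -> u <= v -> hyperadd (x u) (x v) = [set x u].

(* Functions of z > 0 are total functions R -> R whose values at z <= 0
   are irrelevant. *)
Definition Bbp (R : realType) : set (R -> R) :=
  [set f : R -> R | exists (V : R) (x : R -> R),
    [/\ 0 <= V,
        measurable_fun `[0, V] x,
        forall u : R, 0 <= u <= V -> -1 <= x u <= 1,
        nested_on `[0, V] x &
        forall z : R, 0 < z ->
          ((f z)%:E =
             \int[lebesgue_measure]_(u in `[0%R, V]) (bracket (x u) z)%:E)%E]].

Definition ray (R : realType) (s0 : \bar R) : set R :=
  [set s : R | (s0 < s%:E)%E].

(* s0 = +oo (empty ray) must be allowed: it is the only choice for f = 0,
   because g does not vanish and the order condition excludes cancellation. *)
Definition exp_representation (R : realType) (f : R -> R)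
    (s0 : \bar R) (g : R -> R) : Prop :=
  [/\ (-oo < s0)%E,
      measurable_fun (ray s0) g,
      forall s : R, ray s0 s -> -1 <= g s <= 1 /\ g s != 0,
      nested_on (ray s0) g &
      forall z : R, 0 < z ->
        ((f z)%:E =
           \int[lebesgue_measure]_(s in ray s0)
             (bracket (g s) z * expR (- s))%:E)%E].

(* Main.v *)
Require Import Defs.
From HB Require Import structures.
From mathcomp Require Import all_boot all_order all_algebra.
From mathcomp Require Import all_classical all_reals all_analysis.
From mathcomp Require Import measurable_realfun ring lra.
Import Order.TTheory GRing.Theory Num.Theory.
Import numFieldNormedType.Exports.
Local Open Scope classical_set_scope.
Local Open Scope ring_scope.

(** The condition on the hypersums says that [s |-> `|x s|] is nonincreasing
    and that [x] is constant on each level set of its absolute value; in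
    particular the sign of [x] is a function of [`|x|], so that nothing cancels
    in the integral.

    Existence is a change of variables. The function [x] on [0, V] is nonzero up
    to [W], the supremum of its support, and zero afterwards. The chart
    [s |-> W - expR (- s)] maps the ray [s > - ln W] increasingly onto ]0, W[ and
    turns [expR (- s) ds] into Lebesgue measure [exp_measure_chart], so
    [g s := x (W - expR (- s))] represents [f]; if [W = 0] then [f = 0] and the
    empty ray is the answer.

    Uniqueness looks at the law of [g], the image on the real line of the
    measure [expR (- s) ds] on the ray. Then [f z] is the integral of
    [bracket y z] against this law, so the powers [z = 1, 2, ...] give the
    moments of its odd part. On ]0, 1] a finite measure is determined by its
    positive integer moments, because the indicator of [a <= y] is a bounded
    pointwise limit of polynomials [1 - (1 - y ^+ n) ^+ k]; hence two
    representations of [f] have laws with the same odd part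
    [odd_moment_unique].

    It remains to recover a law from its odd part. The sign of [g] is a Borel
    function of [`|g|] [nested_on_measurable_sign]: some Borel set [E] contains
    [`|g s|] exactly when [g s > 0]. Read against [E], the odd part of the law of
    [g] has the full mass of the law of [`|g|], and this mass is at most that of
    the law of [`|g'|] for any other representation [g'], the defect being twice
    the mass where the sign of [g'] disagrees with [E] [sign_rigidity].
    Exchanging the roles of [g] and [g'] shows that there is no defect. So the
    total masses [expR (- s0)] agree, the signs agree almost everywhere as
    functions of the absolute values, and each set [q <= `|g s|] has the same
    mass as the set [q <= `|g' s|]. Both are initial segments of the ray, hence
    they agree up to a null set, and letting [q] run through the rationals gives
    [`|g| = `|g'|] almost everywhere. *)

(** * Nested functions and rays *)

(** The interval from [- `|a|] to [`|a|] is the singleton of [a] only for [a = 0],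
    and then [b = - a] is the case [a = b]. *)
Lemma hyperadd_eql {R : realType} (a b : R) :
  hyperadd a b = [set a] <-> `|b| < `|a| \/ a = b.
Proof.
rewrite /hyperadd; split; last by move=> [->//|->]; rewrite eqxx orbT.
have [ab|ba] := ltP `|b| `|a|; first by left.
have [->|neab] := eqVneq a b; first by right.
have [ab|] := ltP `|a| `|b| => /=.
  by move=> /seteqP[/(_ b erefl)/= e _]; rewrite e ltxx in ab.
move=> {}ba' e; have {ba ba'} ba : `|b| = `|a| by apply/eqP; rewrite eq_le ba ba'.
have /seteqP[h _] := e.
have ha : - `|a| <= `|a| by rewrite (@le_trans _ _ 0)// oppr_le0.
have h1 := h `|a|; have h2 := h (- `|a|); rewrite /= ?lexx ha in h1 h2.
have a0 : `|a| = 0.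
  by move: (h1 isT) (h2 isT) => /=; set n := `|a|; lra.
by move: ba; rewrite a0 => /normr0_eq0 ->; right; apply/normr0_eq0.
Qed.

Lemma nested_onP {R : realType} (D : set R) (x : R -> R) :
  nested_on D x <->
  forall u v, D u -> D v -> u <= v -> `|x v| < `|x u| \/ x u = x v.
Proof. by split=> h u v Du Dv uv; apply/hyperadd_eql/h. Qed.

Lemma nested_on_norm {R : realType} (D : set R) (x : R -> R) :
  nested_on D x -> forall u v, D u -> D v -> u <= v -> `|x v| <= `|x u|.
Proof.
by move=> /nested_onP nx u v Du Dv uv; have [/ltW|->] := nx u v Du Dv uv.
Qed.

Lemma nested_on_eq_norm {R : realType} (D : set R) (x : R -> R) :
  nested_on D x -> forall u v, D u -> D v -> `|x u| = `|x v| -> x u = x v.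
Proof.
move=> /nested_onP nx u v Du Dv e.
by have [uv|/ltW vu] := leP u v; [have [|] := nx u v Du Dv uv|
  have [|->//] := nx v u Dv Du vu]; rewrite // e ltxx.
Qed.

Lemma ray_le {R : realType} (s0 : \bar R) (s t : R) : ray s0 s -> s <= t -> ray s0 t.
Proof. by rewrite /ray/= => h st; rewrite (lt_le_trans h)// lee_fin. Qed.

Lemma measurable_ray {R : realType} (s0 : \bar R) : measurable (ray s0).
Proof.
case: s0 => [r| |]; rewrite /ray.
- by rewrite (_ : [set _ | _] = `]r, +oo[%classic)//;
    apply/seteqP; split=> s /=; rewrite in_itv/= andbT lte_fin.
- by rewrite (_ : [set _ | _] = set0)//; apply/seteqP; split.
- by rewrite (_ : [set _ | _] = setT)//; apply/seteqP; split => s //=; rewrite ltNyr.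
Qed.

(** * The measure with density expR (- s) on a ray *)

(** The proof that the ray is bounded below is what makes the measure finite;
    carrying it in the term lets the finite measure structure be inferred. *)
Definition exp_measure {R : realType} {s0 : \bar R} of (-oo < s0)%E :=
  fun A : set (measurableTypeR R) =>
    (\int[lebesgue_measure]_(s in A `&` ray s0) (expR (- s))%:E)%E.

Lemma measurable_expRN {R : realType} (D : set R) :
  measurable_fun D (fun s : R => expR (- s)).
Proof. by apply: measurable_funTS; apply: measurableT_comp. Qed.

Section exp_measure.
Context {R : realType} {s0 : \bar R} (s0gt : (-oo < s0)%E).
Local Notation mu := (exp_measure s0gt).

Let mu0 : mu set0 = 0%E.
Proof. by rewrite /exp_measure set0I integral_set0. Qed.

Let mu_ge0 A : (0 <= mu A)%E.
Proof. by apply: integral_ge0 => s _; rewrite lee_fin expR_ge0. Qed.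

Let mu_sigma_additive : semi_sigma_additive mu.
Proof.
move=> F mF tF mUF; rewrite /exp_measure; apply: cvg_toP.
  apply: ereal_nondecreasing_is_cvgn => m n mn.
  by apply: lee_sum_nneg_natr => // k _ _; exact: mu_ge0.
rewrite setI_bigcupl ge0_integral_bigcup//=.
- by move=> n; apply: measurableI => //; exact: measurable_ray.
- by apply/measurable_EFinP; exact: measurable_expRN.
- exact: trivIset_setIr.
Qed.

HB.instance Definition _ := isMeasure.Build _ _ _
  mu mu0 mu_ge0 mu_sigma_additive.

End exp_measure.

Lemma integral_expRN_ray {R : realType} (r : R) :
  (\int[lebesgue_measure]_(s in ray r%:E) (expR (- s))%:E)%E = (expR (- r))%:E.
Proof.
have -> : ray r%:E = `]r, +oo[%classic.
  by apply/seteqP; split=> s; rewrite /ray /= in_itv/= andbT lte_fin.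
rewrite integral_itv_obnd_cbnd; last first.
  by apply/measurable_EFinP; exact: measurable_expRN.
have cexp : continuous (fun s : R => expR (- s)).
  by move=> s; apply: continuous_comp; [exact: opp_continuous|exact: continuous_expR].
rewrite (@ge0_continuous_FTC2y _ _ (fun s => - expR (- s)) _ 0)//.
- by rewrite sub0e EFinN oppeK.
- exact: continuous_subspaceT.
- rewrite -oppr0; apply: cvgN; exact: cvgr_expR.
- by apply: cvgN; apply: cvg_at_right_filter; exact: cexp.
- move=> s _; rewrite derive1N// derive1_comp// derive1E.
  have /funeqP -> := @derive_expR R.
  by rewrite derive1N// derive1_id mulrN1 opprK.
Qed.

Lemma exp_measure_setT {R : realType} (s0 : \bar R) (s0gt : (-oo < s0)%E) :
  exp_measure s0gt setT = (if s0 is r%:E then expR (- r) else 0)%:E.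
Proof.
rewrite /exp_measure setTI; case: s0 s0gt => [r| |]// _.
  exact: integral_expRN_ray.
by rewrite (_ : ray _ = set0) ?integral_set0//; apply/seteqP; split.
Qed.

Section exp_measure_finite.
Context {R : realType} {s0 : \bar R} (s0gt : (-oo < s0)%E).
Local Notation mu := (exp_measure s0gt).

Let mu_fin : fin_num_fun mu.
Proof.
move=> A mA; rewrite ge0_fin_numE ?measure_ge0//.
apply: (@le_lt_trans _ _ (mu setT)); first by rewrite le_measure ?inE.
by rewrite /= exp_measure_setT ltry.
Qed.

HB.instance Definition _ := Measure_isFinite.Build _ _ _ mu mu_fin.

End exp_measure_finite.

(** The density vanishes nowhere, so on the ray this measure and Lebesgue measure
    have the same null sets. *)
Lemma exp_measure_null {R : realType} (s0 : \bar R) (s0gt : (-oo < s0)%E) (A : set R) :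
  measurable A -> exp_measure s0gt A = 0%E <-> lebesgue_measure (A `&` ray s0) = 0%E.
Proof.
move=> mA; have mI : measurable (A `&` ray s0).
  by apply: measurableI => //; exact: measurable_ray.
have me : measurable_fun (A `&` ray s0) (EFin \o (fun s : R => expR (- s))).
  by apply/measurable_EFinP; exact: measurable_expRN.
split=> h; last exact: null_set_integral.
have /(ae_eq_integral_abs lebesgue_measure mI me) [N [mN N0 hN]] :
    (\int[lebesgue_measure]_(s in A `&` ray s0) `|(expR (- s))%:E|)%E = 0%E.
  by rewrite -h; apply: eq_integral => s _; rewrite gee0_abs// lee_fin expR_ge0.
apply: (subset_measure0 (mu := lebesgue_measure) mI mN _ N0) => s As.
apply: hN => /(_ As) /eqP.
by rewrite eqe gt_eqF// expR_gt0.
Qed.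

(** By uniqueness of Radon-Nikodym derivatives, the derivative with respect to
    Lebesgue measure is [expR (- s)] on the ray and [0] elsewhere. *)
Lemma integral_exp_measure {R : realType} (s0 : \bar R) (s0gt : (-oo < s0)%E)
    (F : R -> R) :
  measurable_fun setT F -> (forall s, `|F s| <= 1) ->
  (\int[exp_measure s0gt]_s (F s)%:E =
   \int[lebesgue_measure]_(s in ray s0) (F s * expR (- s))%:E)%E.
Proof.
move=> mF F1.
pose nu : {finite_measure set (measurableTypeR R) -> \bar R} := exp_measure s0gt.
pose la : {sigma_finite_measure set (measurableTypeR R) -> \bar R} := lebesgue_measure.
pose e := EFin \o (fun s : R => expR (- s)).
have me D : measurable_fun D (e : measurableTypeR R -> _).
  by apply/measurable_EFinP; exact: measurable_expRN.
have nula : nu `<< la.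
  apply/null_content_dominatesP => A mA /= lA0; apply/exp_measure_null => //.
  apply: (subset_measure0 (mu := lebesgue_measure) _ mA _ lA0) => //.
  by apply: measurableI => //; exact: measurable_ray.
have inu : nu.-integrable setT (EFin \o F).
  apply: measurable_bounded_integrable => //.
    by rewrite ltey_eq fin_num_measure.
  by exists 1; split => // M M1 s _; exact: le_trans (F1 s) (ltW M1).
have hd : ae_eq la setT (Radon_Nikodym (charge_of_finite_measure nu) la) (e \_ (ray s0)).
  apply: integral_ae_eq => //.
  - exact: Radon_Nikodym_integrable.
  - by apply/(measurable_restrictT _ (measurable_ray s0)); exact: me.
  - move=> E _ mE; rewrite -Radon_Nikodym_integral//=.
    by rewrite -integral_mkcondr.
transitivity (\int[la]_s ((F s)%:E *
    Radon_Nikodym (charge_of_finite_measure nu) la s))%E.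
  exact/esym/(Radon_Nikodym_change_of_variables nula measurableT inu).
rewrite [RHS]integral_mkcond.
apply: ae_eq_integral => //.
- apply: emeasurable_funM; first exact/measurable_EFinP.
  exact: measurable_int (Radon_Nikodym_integrable _).
- apply/(measurable_restrictT _ (measurable_ray s0)).
  apply/measurable_EFinP; apply: measurable_funM; first exact: measurable_funTS.
  exact: measurable_expRN.
- apply: filterS hd => s /(_ I) -> _; rewrite !patchE.
  by case: ifPn => _; rewrite ?mule0// EFinM.
Qed.

(** * Existence by an exponential change of variables *)
Lemma exp_chart_ray {R : realType} (W s : R) : 0 < W ->
  ray (- ln W)%:E s <-> 0 < W - expR (- s).
Proof.
move=> W0; rewrite /ray/= lte_fin subr_gt0 -[in X in _ <-> X](lnK W0) ltr_expR.
by rewrite ltrNl.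
Qed.

Lemma measurable_exp_chart {R : realType} (W : R) (D : set R) :
  measurable_fun D (fun s => W - expR (- s)).
Proof. by apply: measurable_funB => //; exact: measurable_expRN. Qed.

(** It is enough to compare the two measures on the half-lines [b < u], which
    generate the Borel sets. For [0 <= b < W] the chart pulls the half-line back
    to the ray starting at [- ln (W - b)], whose mass is [W - b]. *)
Lemma exp_measure_chart {R : realType} (W : R) (W0 : 0 < W) (A : set R) :
  measurable A ->
  exp_measure (ltNyr (- ln W)) ((fun s => W - expR (- s)) @^-1` A) =
  lebesgue_measure (A `&` `]0, W[).
Proof.
move=> mA; set m := exp_measure _; set phi := fun s => _.
have mD : measurable (`]0, W[%classic : set (measurableTypeR R)) by exact: measurable_itv.
have mphi : measurable_fun setT (phi : measurableTypeR R -> measurableTypeR R).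
  exact: measurable_exp_chart.
pose phim : {mfun measurableTypeR R >-> measurableTypeR R} :=
  HB.pack (phi : measurableTypeR R -> measurableTypeR R)
    (isMeasurableFun.Build _ _ _ _ _ mphi).
have rayW b : 0 <= b -> b < W ->
    phi @^-1` `]b, +oo[ `&` ray (- ln W)%:E = ray (- ln (W - b))%:E.
  move=> b0 bW; have Wb : 0 < W - b by rewrite subr_gt0.
  apply/seteqP; split => s /=; rewrite /= in_itv/= andbT /phi.
    by move=> [bs _]; apply/exp_chart_ray => //; lra.
  by move=> /(exp_chart_ray _ _ Wb) h; split; [|apply/exp_chart_ray => //]; lra.
have tail b : m (phi @^-1` `]b, +oo[) = lebesgue_measure (`]b, +oo[ `&` `]0, W[).
  have posb b' : 0 <= b' ->
      m (phi @^-1` `]b', +oo[) = lebesgue_measure (`]b', +oo[ `&` `]0, W[).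
    move=> b0; have [bW|Wb] := ltP b' W.
      rewrite /m /exp_measure rayW// integral_expRN_ray opprK lnK ?posrE ?subr_gt0//.
      rewrite (_ : _ `&` _ = `]b', W[%classic).
        by rewrite lebesgue_measure_itv/= lte_fin bW EFinB.
      apply/seteqP; split => u /=; rewrite !in_itv/= ?andbT; first by move=> [-> /andP[]].
      by move=> /andP[bu ->]; rewrite bu (le_lt_trans b0 bu).
    rewrite (_ : _ @^-1` _ = set0) ?measure0.
      rewrite (_ : _ `&` _ = set0) ?measure0//; apply/seteqP; split => // u /=.
      by rewrite !in_itv/= andbT => -[bu /andP[_ uW]]; have := lt_trans bu uW; lra.
    apply/seteqP; split => // s /=; rewrite in_itv/= andbT /phi => h.
    by have := expR_gt0 (- s); lra.
  have [b0|b0] := leP 0 b; first exact: posb.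
  have -> : m (phi @^-1` `]b, +oo[) = m (phi @^-1` `]0, +oo[).
    rewrite /m /exp_measure; congr integral; apply/seteqP.
    split => s /=; rewrite !in_itv/= !andbT => -[h sr]; split => //.
      exact/exp_chart_ray.
    exact: lt_trans h.
  rewrite posb//; congr (lebesgue_measure _); apply/seteqP.
  split => u /=; rewrite !in_itv/= !andbT => -[h /andP[u0 uW]];
    rewrite u0 uW; split => //.
  exact: lt_trans u0.
have uniqueness := @measure_unique _ R (measurableTypeR R)
  (@RGenOInfty.G R) (fun k => `]- k%:R, +oo[%classic) _ _ _ _
  (pushforward (exp_measure (ltNyr (- ln W))) phim) (mrestr lebesgue_measure mD).
apply: uniqueness => //.
- exact: RGenOInfty.measurableE.
- move=> _ _ [a ->] [b ->]; exists (Num.max a b).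
  apply/seteqP; split => y /=; rewrite !in_itv/= !andbT gt_max.
    by move=> [-> ->].
  by move=> /andP[].
- by move=> k; exists (- k%:R).
- apply/seteqP; split => // y _.
  exists (Num.truncn `|y|).+1 => //=; rewrite in_itv/= andbT ltrNl.
  by rewrite (le_lt_trans _ (truncnS_gt _))// -normrN ler_norm.
- by move=> _ [a ->]; exact: tail.
- move=> k; rewrite -ge0_fin_numE// fin_num_measure//.
Qed.


Lemma integral_exp_chart {R : realType} (W : R) (h : R -> R) : 0 < W ->
  measurable_fun `]0, W[ h -> (forall u, 0 < u < W -> `|h u| <= 1) ->
  (\int[lebesgue_measure]_(u in `]0%R, W[) (h u)%:E =
   \int[lebesgue_measure]_(s in ray (- ln W)%:E)
     (h (W - expR (- s)) * expR (- s))%:E)%E.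
Proof.
move=> W0 mh h1.
pose D : set R := `]0, W[%classic.
have mD : measurable (D : set (measurableTypeR R)) by exact: measurable_itv.
pose h0 : R -> R := h \_ D.
have mh0 : measurable_fun setT h0 by apply/(measurable_restrictT _ mD).
have h01 u : `|h0 u| <= 1.
  rewrite /h0 patchE; case: ifPn => [|_]; last by rewrite normr0.
  by rewrite inE /D/= in_itv/=; exact: h1.
pose phi : measurableTypeR R -> measurableTypeR R := fun s => W - expR (- s).
have mphi : measurable_fun setT phi by exact: measurable_exp_chart.
pose m : {finite_measure set (measurableTypeR R) -> \bar R} :=
  exp_measure (ltNyr (- ln W)).
transitivity (\int[pushforward m phi]_u (h0 u)%:E)%E.
  transitivity (\int[pushforward m phi]_(u in D) (h u)%:E)%E.
    apply: eq_measure_integral => A mA AD.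
    have := exp_measure_chart _ W0 _ mA; rewrite (setIidl AD) => e.
    exact: esym e.
  rewrite [LHS]integral_mkcond; apply: eq_integral => u _.
  by rewrite /h0 !patchE; case: ifPn.
rewrite (@integral_pushforward _ _ (measurableTypeR R) (measurableTypeR R) R phi)//.
- rewrite preimage_setT.
  rewrite (integral_exp_measure _ (ltNyr (- ln W)) (h0 \o phi)
    (measurableT_comp mh0 mphi) (fun s => h01 (phi s))).
  apply: eq_integral => s; rewrite inE => /(exp_chart_ray _ _ W0) sW.
  rewrite /h0 /= patchE mem_set// /D /phi /= in_itv/= sW/=.
  by have := expR_gt0 (- s); lra.
- exact/measurable_EFinP.
- rewrite preimage_setT; apply: measurable_bounded_integrable => //.
  + by rewrite -ge0_fin_numE// fin_num_measure.
  + exact: (measurableT_comp mh0 mphi).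
  + by exists 1; split => // M M1 s _; exact: le_trans (h01 _) (ltW M1).
Qed.

Lemma measurable_sgr {R : realType} : measurable_fun [set: R] (@Num.sg R).
Proof.
have -> : Num.sg = (fun y : R => if 0 < y then 1 else if y < 0 then -1 else 0).
  by apply/funext => y; case: sgrP.
by do 2 (apply: measurable_fun_ifT => //; first exact: measurable_fun_ltr).
Qed.

Lemma measurable_bracket {R : realType} (D : set R) (x : R -> R) (z : R) :
  measurable D -> measurable_fun D x -> measurable_fun D (fun u => bracket (x u) z).
Proof.
move=> mD mx; rewrite /bracket; apply: measurable_funM.
  exact: measurableT_comp measurable_sgr mx.
apply: (measurableT_comp (measurable_powR z)).
by apply: measurableT_comp.
Qed.

Lemma bracket_le1 {R : realType} (y z : R) : 0 < z -> -1 <= y <= 1 ->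
  `|bracket y z| <= 1.
Proof.
move=> z0; rewrite -ler_norml => y1; rewrite /bracket normrM.
rewrite (ger0_norm (powR_ge0 _ _)) mulr_ile1//.
  by rewrite normr_sg lern1 leq_b1.
have : `|y| `^ z <= 1 `^ z by rewrite ge0_ler_powR ?nnegrE// ltW.
by rewrite powR1.
Qed.

Lemma bracket0 {R : realType} (z : R) : bracket 0 z = 0.
Proof. by rewrite /bracket sgr0 mul0r. Qed.

(** By monotonicity of the absolute value, [x] is nonzero before the supremum [W]
    of its support and zero after it, so the interval ]0, W[ carries the whole
    integral and is the domain to be charted by a ray. *)
Lemma exp_representation_exists {R : realType} (f : R -> R) :
  Bbp f -> exists (s0 : \bar R) (g : R -> R), exp_representation f s0 g.
Proof.
move=> [V [x [V0 mx x1 nx fx]]].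
have inV u : 0 <= u <= V -> `[0, V]%classic u by rewrite /= in_itv.
pose S := [set u | 0 <= u <= V /\ x u != 0].
pose W := sup S.
have ubS : ubound S V by move=> u [/andP[]].
have WS u : W < u -> 0 <= u <= V -> x u = 0.
  move=> Wu uV; apply/eqP; apply: contraLR Wu => xu0; rewrite -leNgt.
  by apply: ub_le_sup => //; exists V.
have S0 : S !=set0 \/ W = 0.
  have [e|/set0P] := eqVneq S set0; last by left.
  by right; rewrite /W e sup0.
have [W0 WV] : 0 <= W /\ W <= V.
  case: S0 => [[u Su]|->//]; split; last by apply: ge_sup => //; exists u.
  by apply: (@le_trans _ _ u); [case: Su => /andP[]|apply: ub_le_sup => //; exists V].
have SW u : 0 <= u -> u < W -> x u != 0.
  move=> u0 uW; case: S0 => [S0|W0']; last by move: uW; rewrite W0' ltNge u0.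
  have [v [/andP[v0 vV] xv] uv] := sup_gt S0 uW.
  rewrite -normr_gt0 (lt_le_trans _ (nested_on_norm _ _ nx u v _ _ _)) ?normr_gt0 ?ltW//.
    by apply: inV; rewrite u0 (ltW (lt_le_trans uv vV)).
  by apply: inV; rewrite v0.
have mxW : measurable_fun `]0, W[ x.
  apply: measurable_funS mx => // u /=; rewrite !in_itv/= => /andP[u0 uW].
  by rewrite (ltW u0) (le_trans (ltW uW)).
have fW z : 0 < z ->
    (f z)%:E = (\int[lebesgue_measure]_(u in `]0%R, W[) (bracket (x u) z)%:E)%E.
  move=> z0; rewrite fx// -(integral_itv_bndoo true false); last first.
    by apply/measurable_EFinP; apply: measurable_bracket.
  rewrite [LHS]integral_mkcond [RHS]integral_mkcond; apply: eq_integral => u _.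
  rewrite !patchE !mem_setE !in_itv/=.
  have [u0|] := boolP (0 <= u); last by [].
  rewrite /=; have [uW|Wu] := leP u W; first by rewrite (le_trans uW).
  by case: ifPn => // uV; rewrite WS ?u0 ?bracket0.
have [W00|Wneq0] := eqVneq W 0.
  exists +oo%E, (fun=> 1); have ray0 : ray +oo%E = set0 :> set R.
    by apply/seteqP; split.
  split; rewrite ?ray0//.
  - by move=> z z0; rewrite fW// W00 set_itvoo0 !integral_set0.
have {W0 Wneq0} W0 : 0 < W by rewrite lt0r Wneq0.
exists (- ln W)%:E, (fun s => x (W - expR (- s))).
have rayW s : ray (- ln W)%:E s -> 0 < W - expR (- s) < W.
  by move=> /(exp_chart_ray _ _ W0) ->/=; rewrite ltrBlDr ltrDl expR_gt0.
have rayV s : ray (- ln W)%:E s -> 0 <= W - expR (- s) <= V.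
  by move=> /rayW/andP[h1 h2]; rewrite ltW//= (le_trans (ltW h2)).
split.
- exact: ltNyr.
- apply: (measurable_comp _ _ mxW) => //; last exact: measurable_exp_chart.
  by move=> _ [s /rayW h <-]; rewrite /= in_itv.
- move=> s sr; split; first by apply: x1; exact: rayV.
  by have /andP[h1 h2] := rayW s sr; rewrite SW// ltW.
- apply/nested_onP => s t sr tr st; apply: ((nested_onP _ _).1 nx).
  + exact/inV/rayV.
  + exact/inV/rayV.
  + by rewrite lerD2l lerN2 ler_expR lerN2.
- move=> z z0; rewrite fW// (integral_exp_chart _ (fun u => bracket (x u) z))//.
    exact: measurable_bracket.
  move=> u /andP[u0 uW]; apply: bracket_le1 => //; apply: x1.
  by rewrite ltW//= (le_trans (ltW uW)).
Qed.

(** * Moments on ]0, 1] determine a finite measure *)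
Lemma bernoulli_ge {R : realType} (t : R) (k : nat) :
  -1 <= t -> 1 + k%:R * t <= (1 + t) ^+ k.
Proof.
move=> t1; elim: k => [|k IH]; first by rewrite expr0 mul0r addr0.
rewrite exprS -natr1.
have k0 : 0 <= k%:R :> R by [].
have := ler_wpM2l (_ : 0 <= 1 + t) IH; rewrite -lerBlDl sub0r t1 => /(_ isT).
apply: le_trans.
nra.
Qed.

(** Since [(1 - t) (1 + t) <= 1], the power of [1 - t] is at most the inverse of
    that of [1 + t], which Bernoulli's inequality bounds from below. *)
Lemma bernoulli_le {R : realType} (t : R) (k : nat) :
  0 <= t <= 1 -> (1 - t) ^+ k <= (1 + k%:R * t)^-1.
Proof.
move=> /andP[t0 t1].
have k0 : 0 <= k%:R * t by rewrite mulr_ge0.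
rewrite -[leRHS]div1r ler_pdivlMr ?ltr_wpDr//.
have h : 1 + k%:R * t <= (1 + t) ^+ k by apply: bernoulli_ge; lra.
apply: (le_trans (ler_wpM2l _ h)); first by rewrite exprn_ge0// subr_ge0.
rewrite -exprMn exprn_ile1//; nra.
Qed.

(** With [q = r ^+ 2], Bernoulli's inequality bounds [n * r ^+ n], and the
    remaining factor [r ^+ n] tends to [0]. *)
Lemma cvg_natX {R : realType} (q : R) : 0 <= q < 1 ->
  (fun n => n%:R * q ^+ n : R) @ \oo --> (0 : R).
Proof.
move=> /andP[q0 q1].
have [->|qn0] := eqVneq q 0.
  apply: (@cvg_trans _ ((fun=> 0 : R) @ \oo)); last exact: cvg_cst.
  apply: near_eq_cvg; near=> n; rewrite expr0n.
  by have [->|_] := eqVneq n 0%N; rewrite ?mul0r ?mulr0.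
have qp : 0 < q by rewrite lt0r qn0.
pose r := Num.sqrt q.
have r0 : 0 < r by rewrite sqrtr_gt0.
have qr : q = r * r by rewrite -expr2 sqr_sqrtr.
have r1 : r < 1 by rewrite /r -sqrtr1 ltr_sqrt.
pose d := r^-1 - 1.
have d0 : 0 < d by rewrite subr_gt0 invf_gt1.
have nr n : n%:R * r ^+ n <= d^-1.
  have h : 1 + n%:R * d <= (1 + d) ^+ n by apply: bernoulli_ge; lra.
  have -> : r = (1 + d)^-1 by rewrite /d addrC subrK invrK.
  have d1 : 0 < (1 + d) ^+ n by rewrite exprn_gt0//; lra.
  rewrite exprVn ler_pdivrMr// [leRHS]mulrC ler_pdivlMr//; lra.
apply: (@squeeze_cvgr _ _ _ _ (fun=> 0) (fun n => d^-1 * r ^+ n)).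
- near=> n; rewrite mulr_ge0 ?exprn_ge0//=.
  by rewrite qr exprMn mulrA ler_wpM2r// exprn_ge0// ltW.
- exact: cvg_cst.
- have := @cvg_geometric R d^-1 r; rewrite ger0_norm ?ltW//; exact.
Unshelve. all: by end_near. Qed.

(** A polynomial in [y] without constant term when [0 < n]; for large [n] and
    suitable [k] it is close to the indicator of a half-line on ]0, 1]. *)
Definition bump {R : realType} (n k : nat) (y : R) : R := 1 - (1 - y ^+ n) ^+ k.

Lemma bump_range {R : realType} (n k : nat) (y : R) :
  0 <= y <= 1 -> 0 <= bump n k y <= 1.
Proof.
move=> /andP[y0 y1]; rewrite /bump.
have h0 : 0 <= y ^+ n by rewrite exprn_ge0.
have h1 : y ^+ n <= 1 by rewrite exprn_ile1.
have g0 : 0 <= (1 - y ^+ n) ^+ k by rewrite exprn_ge0// subr_ge0.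
have g1 : (1 - y ^+ n) ^+ k <= 1 by rewrite exprn_ile1//; lra.
lra.
Qed.

(** For [0 < a <= 1] take [k] of the order of [n / a ^+ n]. If [y < a], then
    [k * y ^+ n] is of the order of [n * (y / a) ^+ n], which tends to [0], and
    so does the bump. If [a <= y], then [k * y ^+ n] is at least [n], hence
    [(1 - y ^+ n) ^+ k] is at most [1 / (1 + n)]. The factor [n] in [k] serves
    the boundary case [y = a]. The other values of [a] need only the bumps
    [1 - (1 - y) ^+ k] and [0]. *)
Lemma bump_cvg_indic {R : realType} (a : R) :
  exists n k : nat -> nat, forall y : R, 0 < y <= 1 ->
    (fun i => bump (n i).+1 (k i) y) @ \oo --> ((a <= y)%R%:R : R).
Proof.
have [a0|a0] := leP a 0.
  exists (fun=> 0%N), id => y /andP[y0 y1].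
  rewrite (le_trans a0 (ltW y0)) -[X in _ --> X]subr0 /bump.
  apply: cvgB; first exact: cvg_cst.
  rewrite [X in X @ _](_ : _ = geometric 1 (1 - y)).
    by apply: cvg_geometric; rewrite ltr_norml; lra.
  by apply/funext => i; rewrite /= mul1r expr1.
have [a1|a1] := ltP 1 a.
  exists (fun=> 0%N), (fun=> 0%N) => y /andP[y0 y1].
  have -> : (a <= y) = false by apply/negbTE; rewrite -ltNge (le_lt_trans y1).
  by rewrite /bump expr0 subrr; exact: cvg_cst.
pose k i := (Num.truncn (i.+1%:R * a^-1 ^+ i.+1)).+1.
have ai i : 1 <= a^-1 ^+ i.+1 :> R by rewrite exprn_ege1// invf_ge1.
have klo i : i.+1%:R * a^-1 ^+ i.+1 <= (k i)%:R by exact/ltW/truncnS_gt.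
have khi i : (k i)%:R <= 2 * (i.+1%:R * a^-1 ^+ i.+1).
  have h0 : 1 <= i.+1%:R * a^-1 ^+ i.+1 :> R.
    by rewrite (le_trans (ai i))// ler_peMl ?ler1n// (le_trans _ (ai i)).
  rewrite /k -natr1 mulr2n mulrDl !mul1r lerD// truncn_le.
  exact: le_trans h0.
exists id, k => y /andP[y0 y1].
have yn i : 0 <= y ^+ i <= 1 by rewrite exprn_ge0 ?exprn_ile1// ltW.
have [ay|ya] := leP a y.
- rewrite -[X in _ --> X]subr0 /bump.
  apply: cvgB; first exact: cvg_cst.
  apply: (@squeeze_cvgr _ _ _ _ (fun=> 0) (fun i => i.+1%:R^-1)).
  + near=> i; have /andP[h0 h1] := yn i.+1; rewrite exprn_ge0 ?subr_ge0//=.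
    apply: le_trans (bernoulli_le _ _ (yn i.+1)) _.
    rewrite lef_pV2 ?posrE// ?ltr_pwDl ?mulr_ge0//.
    rewrite (@le_trans _ _ ((k i)%:R * y ^+ i.+1)) ?lerDr//.
    apply: le_trans (ler_wpM2r h0 (klo i)); rewrite -mulrA ler_peMr//.
    by rewrite -exprMn exprn_ege1// mulrC ler_pdivlMr ?mul1r.
  + exact: cvg_cst.
  + exact: cvg_harmonic.
- apply: (@squeeze_cvgr _ _ _ _ (fun=> 0)
    (fun i => 2 * (i.+1%:R * (y / a) ^+ i.+1))).
  + near=> i; have /andP[h0 h1] := yn i.+1.
    have /(bump_range i.+1 (k i))/andP[-> _] : 0 <= y <= 1 by rewrite ltW.
    rewrite /bump lerBlDr -lerBlDl.
    have h : 1 + (k i)%:R * - y ^+ i.+1 <= (1 - y ^+ i.+1) ^+ k i.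
      by apply: bernoulli_ge; lra.
    apply: le_trans h; rewrite mulrN lerD2l lerN2.
    rewrite exprMn (mulrC (y ^+ _)) !mulrA ler_wpM2r//.
    by rewrite -mulrA.
  + exact: cvg_cst.
  + rewrite -[X in _ --> X](mulr0 (2 : R)).
    apply: cvgM; first exact: cvg_cst.
    have := @cvg_natX R (y / a); rewrite divr_ge0 ?ltW//= ltr_pdivrMr// mul1r.
    by move=> /(_ ya); rewrite -(cvg_shiftS (fun n => n%:R * (y/a) ^+ n : R)).
Unshelve. all: by end_near. Qed.

Lemma measurable_bump {R : realType} (n k : nat) (D : set R) :
  measurable_fun D (@bump R n k).
Proof.
rewrite /bump; apply: measurable_funB => //; apply: measurable_funX.
by apply: measurable_funB => //; exact: exprn_measurable.
Qed.

Lemma integral_bump {R : realType}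
    (mu nu : {finite_measure set (measurableTypeR R) -> \bar R}) :
  (forall k, \int[mu]_(y in `]0%R, 1%R]) (y ^+ k.+1)%:E =
             \int[nu]_(y in `]0%R, 1%R]) (y ^+ k.+1)%:E)%E ->
  forall n k, (\int[mu]_(y in `]0%R, 1%R]) (bump n.+1 k y)%:E =
               \int[nu]_(y in `]0%R, 1%R]) (bump n.+1 k y)%:E)%E.
Proof.
move=> hmom n.
pose D : set R := `]0, 1]%classic.
have mD : measurable (D : set (measurableTypeR R)) by exact: measurable_itv.
pose q j k (y : R) := y ^+ j.+1 * (1 - y ^+ n.+1) ^+ k.
have mq j k : measurable_fun D (q j k).
  apply: measurable_funM; first exact: exprn_measurable.
  by apply: measurable_funX; apply: measurable_funB => //; exact: exprn_measurable.
have mb k := @measurable_bump R n.+1 k D.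
have ibl (la : {finite_measure set (measurableTypeR R) -> \bar R}) (h : R -> R) :
    measurable_fun D h -> (forall y, 0 < y <= 1 -> `|h y| <= 1) ->
    la.-integrable D (fun y => (h y)%:E).
  move=> mh h1; apply: measurable_bounded_integrable => //.
    by rewrite ltey_eq fin_num_measure.
  exists 1; split => // M M1 y; rewrite /D/= in_itv/= => /h1 /le_trans; apply.
  exact: ltW.
have bq j k y : 0 < y <= 1 -> `|q j k y| <= 1.
  move=> /andP[y0 y1]; have yn m : 0 <= y ^+ m <= 1.
    by rewrite exprn_ge0 ?exprn_ile1// ltW.
  have /andP[h0 h1] := yn n.+1; have /andP[g0 g1] := yn j.+1.
  rewrite ger0_norm; last by rewrite mulr_ge0// exprn_ge0// subr_ge0.
  by rewrite mulr_ile1// ?exprn_ge0 ?exprn_ile1// ?subr_ge0//; lra.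
have bb k (y : R) : 0 < y <= 1 -> `|bump n.+1 k y| <= 1.
  move=> /andP[y0 y1].
  have /(bump_range n.+1 k)/andP[h0 h1] : 0 <= y <= 1 by rewrite ltW.
  by rewrite ger0_norm.
(* Expanding one factor [1 - y ^+ n.+1] at a time reduces the bumps to the
   products [q j k], and these to the powers [y ^+ j.+1]. *)
have hq k : forall j, (\int[mu]_(y in D) (q j k y)%:E = \int[nu]_(y in D) (q j k y)%:E)%E.
  elim: k => [|k IH] j.
    under eq_integral do rewrite /q expr0 mulr1.
    by under [RHS]eq_integral do rewrite /q expr0 mulr1.
  have e (la : {finite_measure set (measurableTypeR R) -> \bar R}) :
     (\int[la]_(y in D) (q j k.+1 y)%:E =
      \int[la]_(y in D) (q j k y)%:E - \int[la]_(y in D) (q (j + n.+1)%N k y)%:E)%E.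
    rewrite -integralB//;
      [|exact: (ibl la _ (mq j k) (bq j k))|exact: (ibl la _ (mq _ k) (bq _ k))].
    apply: eq_integral => y _; rewrite -EFinB; congr (_%:E).
    by rewrite /q [(1 - _) ^+ k.+1]exprS -[(j + n.+1).+1]addSn exprD; ring.
  by rewrite !e !IH.
elim=> [|k IH].
  by under eq_integral do rewrite /bump expr0 subrr;
     under [RHS]eq_integral do rewrite /bump expr0 subrr; rewrite !integral0.
have e (la : {finite_measure set (measurableTypeR R) -> \bar R}) :
    (\int[la]_(y in D) (bump n.+1 k.+1 y)%:E =
     \int[la]_(y in D) (bump n.+1 k y)%:E + \int[la]_(y in D) (q n k y)%:E)%E.
  rewrite -integralD//;
    [|exact: (ibl la _ (mb k) (bb k))|exact: (ibl la _ (mq n k) (bq n k))].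
  apply: eq_integral => y _; rewrite -EFinD; congr (_%:E).
  by rewrite /bump /q [(1 - _) ^+ k.+1]exprS; ring.
by rewrite !e IH hq.
Qed.

(** By dominated convergence along the bumps, the two measures agree on the
    traces of the half-lines [a <= y], which generate the Borel sets. The moment
    of order zero is not assumed, so a mass at [0] stays free. *)
Lemma hausdorff_moment_unique {R : realType}
    (mu nu : {finite_measure set (measurableTypeR R) -> \bar R}) :
  (forall k, \int[mu]_(y in `]0%R, 1%R]) (y ^+ k.+1)%:E =
             \int[nu]_(y in `]0%R, 1%R]) (y ^+ k.+1)%:E)%E ->
  forall A : set R, measurable A -> A `<=` `]0, 1] -> mu A = nu A.
Proof.
move=> hmom.
pose D : set R := `]0, 1]%classic.
have mD : measurable (D : set (measurableTypeR R)) by exact: measurable_itv.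
have tail a : mu (D `&` `[a, +oo[) = nu (D `&` `[a, +oo[).
  have [n [k hnk]] := bump_cvg_indic a.
  have tl (la : {finite_measure set (measurableTypeR R) -> \bar R}) :
     (\int[la]_(y in D) (bump (n i).+1 (k i) y)%:E @[i --> \oo] -->
      la (D `&` `[a, +oo[))%E.
    have -> : la (D `&` `[a, +oo[) = (\int[la]_(y in D) ((a <= y)%R%:R)%:E)%E.
      rewrite setIC -integral_indic//.
      apply: eq_integral => y _; rewrite indicE/=; congr ((nat_of_bool _)%:R%:E).
      by apply/idP/idP; rewrite inE/= in_itv/= andbT.
    apply: (@dominated_cvg _ (measurableTypeR R) R la D mD
      (fun i y => (bump (n i).+1 (k i) y)%:E) (fun y => ((a <= y)%R%:R)%:E)
      (cst 1%E)) => //=.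
    - by move=> i; apply/measurable_EFinP; exact: measurable_bump.
    - move=> y; rewrite /D/= in_itv/= => y01.
      by apply: cvg_EFin; [near=> i|exact: hnk].
    - exact: finite_measure_integrable_cst.
    - move=> i y; rewrite /D/= in_itv/= => /andP[y0 y1]; rewrite lee_fin.
      have /(bump_range (n i).+1 (k i))/andP[h0 h1] : 0 <= y <= 1 by rewrite ltW.
      by rewrite ger0_norm.
  have eqb i : (\int[mu]_(y in D) (bump (n i).+1 (k i) y)%:E =
                \int[nu]_(y in D) (bump (n i).+1 (k i) y)%:E)%E.
    exact: integral_bump.
  have := tl mu; under eq_cvg do rewrite eqb.
  by move=> /(cvg_unique (@ereal_hausdorff R))/(_ (tl nu)).
move=> A mA AD.
have -> : mu A = mrestr mu mD A by rewrite /mrestr setIidl.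
have -> : nu A = mrestr nu mD A by rewrite /mrestr setIidl.
have uniqueness := @measure_unique _ R (measurableTypeR R) (@RGenCInfty.G R)
  (fun k => `[- k%:R, +oo[%classic) _ _ _ _ (mrestr mu mD) (mrestr nu mD).
apply: uniqueness => //.
- exact: RGenCInfty.measurableE.
- move=> _ _ [a ->] [b ->]; exists (Num.max a b).
  apply/seteqP; split => y /=; rewrite !in_itv/= !andbT ge_max.
    by move=> [-> ->].
  by move=> /andP[].
- by move=> k; exists (- k%:R).
- apply/seteqP; split => // y _.
  exists (Num.truncn `|y|).+1 => //=; rewrite in_itv/= andbT lerNl.
  by rewrite (le_trans _ (ltW (truncnS_gt _)))// -normrN ler_norm.
- by move=> _ [a ->]; rewrite /= /mrestr setIC tail setIC.
- move=> k; rewrite /= /mrestr ltey_eq fin_num_measure//.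
  exact: measurableI.
Unshelve. all: by end_near. Qed.

(** * The sign of a nested function is a Borel function of its absolute value *)

(** Let [Y] be the countable set of values of [`|g|] at rational points. Every
    level set of [`|g|] with more than one point lies over [Y], since it is an
    interval and contains a rational. Away from these levels [`|g|] is strictly
    decreasing, and the sets [B] which coincide there with the preimage under
    [`|g|] of a Borel set form a sigma-algebra containing the half-lines, hence
    all Borel sets; this applies to [B] the set where [g] is positive. On the
    countably many remaining levels the sign is constant and is prescribed level
    by level. *)
Lemma nested_on_measurable_sign {R : realType} (s0 : \bar R) (g : R -> R) :
  measurable_fun (ray s0) g -> nested_on (ray s0) g ->
  exists2 E : set R, measurable E &
    forall s, ray s0 s -> E `|g s| <-> 0 < g s.
Proof.
move=> mg ng.
pose rt := [set q : R | exists2 r : rat, q = ratr r & ray s0 q].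
pose Y : set R := [set `|g q| | q in rt].
have crt : countable rt.
  apply: (@sub_countable _ _ _ [set (ratr r : R) | r in [set: rat]]).
    by apply: subset_card_le => _ [r -> _]; exists r.
  exact/(card_le_trans (card_image_le _ _))/countableP.
have cY : countable Y := card_le_trans (card_image_le _ _) crt.
have levelY s t : ray s0 s -> s < t -> `|g s| = `|g t| -> Y `|g s|.
  move=> s0s st gst; have [r] := rat_in_itvoo st; rewrite in_itv/= => /andP[sr rt'].
  have s0r := ray_le _ _ _ s0s (ltW sr).
  exists (ratr r); first by exists r.
  apply/eqP; rewrite eq_le (nested_on_norm _ _ ng s) ?(ltW sr)// gst.
  by rewrite (nested_on_norm _ _ ng) ?(ltW rt')//; exact: ray_le (ltW st).
pose C := [set B : set R | exists2 E : set R, measurable E &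
  forall s, ray s0 s -> ~ Y `|g s| -> (E `|g s| <-> B s)].
have Cm (B : set R) : measurable B -> C B.
  have -> : (measurable : set (set R)) = <<s RGenCInfty.G (R := R) >>.
    exact: RGenCInfty.measurableE.
  suff : <<s RGenCInfty.G (R := R) >> `<=` C by apply.
  apply: smallest_sub.
    split.
    - by exists set0.
    - move=> A [E mE hE]; exists (~` E); first exact: measurableC.
      by move=> s s0s Ys; rewrite setTD /setC/= hE.
    - move=> A hA; have hA' n : exists En : set R, measurable En /\
          forall s, ray s0 s -> ~ Y `|g s| -> (En `|g s| <-> A n s).
        by have [En mE hE] := hA n; exists En.
      have [E hE] := choice hA'.
      exists (\bigcup_n E n); first by apply: bigcupT_measurable => n; case: (hE n).
      move=> s s0s Ys; split => -[n _ h]; exists n => //;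
        by have [_ /(_ s s0s Ys) [h1 h2]] := hE n; auto.
  move=> _ [t ->].
  have [s0t|ts0] := boolP (t%:E <= s0)%E; last first.
    rewrite -ltNge in ts0.
    exists `]-oo, `|g t|]%classic => // s s0s Ys; rewrite /= !in_itv/= andbT.
    split; last exact: (nested_on_norm _ _ ng).
    move=> h; rewrite leNgt; apply/negP => st; apply: Ys; apply: (levelY s t) => //.
    by apply/eqP; rewrite eq_le h (nested_on_norm _ _ ng) ?(ltW st).
  exists setT => // s s0s _; split => // _; rewrite /= in_itv/= andbT.
  by move: s0s; rewrite /ray/= => /(le_lt_trans s0t); rewrite lte_fin => /ltW.
pose P := ray s0 `&` g @^-1` `]0, +oo[.
have [E0 mE0 hE0] : C P.
  by apply: Cm; apply: mg => //; exact: measurable_ray.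
pose Y0 : set R := [set `|g q| | q in rt `&` [set q | 0 < g q]].
exists ((E0 `\` Y) `|` Y0).
  apply: measurableU; first by apply: measurableD => //; apply: countable_measurable.
  apply: countable_measurable => //; apply: sub_countable cY; apply: subset_card_le.
  by move=> _ [q [rq _] <-]; exists q.
move=> s s0s; split.
  move=> [[/(hE0 s s0s) h /h]|]; first by move=> [_] /=; rewrite in_itv/= andbT.
  by move=> [q [[r _ s0q] /= gq] /(nested_on_eq_norm _ _ ng q s s0q s0s) <-].
move=> gs0; have [Ys|Ys] := pselect (Y `|g s|); last first.
  by left; split => //; apply/hE0 => //; split => //=; rewrite in_itv/= andbT.
right; have [q rq gqs] := Ys; exists q => //; split => //=.
by case: rq => r _ s0q; rewrite (nested_on_eq_norm _ _ ng q s).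
Qed.

(** * The odd part of a finite measure is determined by its bracket moments *)

(** The measurability proof is carried in the term so that the finite measure
    structure can be inferred. *)
Definition image_measure {d1 d2} {T1 : measurableType d1} {T2 : measurableType d2}
    {R : realType} (mu : {finite_measure set T1 -> \bar R}) (phi : T1 -> T2)
    of measurable_fun setT phi := pushforward mu phi.

Section finite_measure_operations.
Context {d1 d2} {T1 : measurableType d1} {T2 : measurableType d2} {R : realType}.
Variables (mu nu : {finite_measure set T1 -> \bar R}) (phi : T1 -> T2).
Hypothesis mphi : measurable_fun setT phi.
Local Notation image := (image_measure mu phi mphi).

Let measurable_preimage A : measurable A -> measurable (phi @^-1` A).
Proof. by move=> mA; rewrite -[X in measurable X]setTI; exact: mphi. Qed.

Let image0 : image set0 = 0%E.
Proof. by rewrite /image_measure /pushforward preimage_set0 measure0. Qed.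

Let image_ge0 A : (0 <= image A)%E.
Proof. by rewrite /image_measure /pushforward measure_ge0. Qed.

Let image_sigma_additive : semi_sigma_additive image.
Proof. exact: measure_semi_sigma_additive. Qed.

HB.instance Definition _ :=
  isMeasure.Build _ _ _ image image0 image_ge0 image_sigma_additive.

Let image_fin : fin_num_fun image.
Proof. by move=> A /measurable_preimage mA; exact: fin_num_measure. Qed.

HB.instance Definition _ := Measure_isFinite.Build _ _ _ image image_fin.

HB.instance Definition _ := Measure.copy (measure_add mu nu)
  (msum (fun n => if n is 0%N then mu : {measure set T1 -> \bar R} else nu) 2).

Let measure_add_fin : fin_num_fun (measure_add mu nu).
Proof. by move=> A mA; rewrite measure_addE fin_numD !fin_num_measure. Qed.

HB.instance Definition _ :=
  Measure_isFinite.Build _ _ _ (measure_add mu nu) measure_add_fin.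

End finite_measure_operations.

Lemma bracket_natP {R : realType} (y : R) (k : nat) :
  bracket y k.+1%:R =
    (if 0 < y then y ^+ k.+1 else if y < 0 then - (- y) ^+ k.+1 else 0).
Proof.
rewrite /bracket powR_mulrn//; case: (ltrgt0P y) => [y0|y0|->].
- by rewrite gtr0_sg// mul1r.
- by rewrite ltr0_sg// mulN1r.
- by rewrite sgr0 mul0r.
Qed.

(** On [-1, 1] the bracket moments of [mu] are the moments on ]0, 1] of [mu] minus
    those of its reflection. Moving the reflections across the equality leaves
    an equality of moments between the positive measures [al] and [be]. *)
Lemma odd_moment_unique {R : realType}
    (mu nu : {finite_measure set (measurableTypeR R) -> \bar R}) :
  (forall k, \int[mu]_(y in `[(-1)%R, 1%R]) (bracket y k.+1%:R)%:E =
             \int[nu]_(y in `[(-1)%R, 1%R]) (bracket y k.+1%:R)%:E)%E ->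
  forall A : set R, measurable A -> A `<=` `]0, 1] ->
  (mu A + nu (-%R @^-1` A) = nu A + mu (-%R @^-1` A))%E.
Proof.
move=> hmom A mA A01.
pose D : set R := `]0, 1]%classic.
have mD : measurable (D : set (measurableTypeR R)) by exact: measurable_itv.
have mopp : measurable_fun setT (-%R : measurableTypeR R -> measurableTypeR R).
  exact: oppr_measurable.
pose al : {finite_measure set (measurableTypeR R) -> \bar R} :=
  measure_add mu (image_measure nu _ mopp).
pose be : {finite_measure set (measurableTypeR R) -> \bar R} :=
  measure_add nu (image_measure mu _ mopp).
have pos_neg (la : {finite_measure set (measurableTypeR R) -> \bar R}) k :
    (\int[la]_(y in `[(-1)%R, 1%R]) (bracket y k.+1%:R)%:E =
     \int[la]_(y in D) (y ^+ k.+1)%:E -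
     \int[image_measure la _ mopp]_(y in D) (y ^+ k.+1)%:E)%E.
  have Xge0 y : 0 < y -> 0 <= y ^+ k.+1 by move=> /ltW; exact: exprn_ge0.
  rewrite integralE; congr (_ - _)%E.
    rewrite [LHS]integral_mkcond [RHS]integral_mkcond; apply: eq_integral => y _.
    rewrite !patchE !mem_setE /D !in_itv/= funeposE bracket_natP.
    have [y0|y0] := ltP 0 y.
      have -> /= : -1 <= y by lra.
       case: ifP => // _.
      by apply/max_idPl; rewrite lee_fin Xge0.
    case: ifP => // _; apply/max_idPr; rewrite lee_fin; case: ifPn => // y0'.
    by rewrite oppr_le0 exprn_ge0// oppr_ge0.
  rewrite /image_measure ge0_integral_pushforward//; last 2 first.
  - by apply/measurable_EFinP; exact: exprn_measurable.
  - by move=> y /set_mem; rewrite /D/= in_itv/= => /andP[/Xge0].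
  rewrite [LHS]integral_mkcond [RHS]integral_mkcond; apply: eq_integral => y _.
  rewrite !patchE mem_setE in_itv/= funenegE bracket_natP.
  have -> : (y \in -%R @^-1` D) = (-1 <= y < 0).
    apply/idP/idP => [/set_mem|h]; last apply/mem_set;
      by rewrite /D/= in_itv/= oppr_gt0 lerNl andbC.
  have [y0|y0] := ltP 0 y.
    rewrite [y < 0]ltNge (ltW y0) andbF; case: ifP => // _.
    by apply/max_idPr; rewrite -EFinN lee_fin oppr_le0 Xge0.
  have [y0'|] := ltP y 0; last by rewrite andbF -EFinN oppr0 maxxx; case: ifP.
  have -> : y <= 1 by lra.
  rewrite ?y0' andbT; case: ifP => // _.
  by rewrite -EFinN opprK; apply/max_idPl; rewrite lee_fin Xge0// oppr_gt0.
have fin (la : {finite_measure set (measurableTypeR R) -> \bar R}) k :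
    (\int[la]_(y in D) (y ^+ k.+1)%:E \is a fin_num)%E.
  suff : la.-integrable D (EFin \o (fun y : R => y ^+ k.+1)).
    exact: integrable_fin_num.
  apply: measurable_bounded_integrable => //.
  - by rewrite -ge0_fin_numE// fin_num_measure.
  - exists 1; split => // M M1 y; rewrite /D/= in_itv/= => /andP[y0 y1].
    rewrite ger0_norm ?exprn_ge0 ?(ltW y0)// (le_trans _ (ltW M1))//.
    by rewrite exprn_ile1// ltW.
have := @hausdorff_moment_unique R al be _ A mA A01.
rewrite /= !measure_addE; apply => k.
have mX : measurable_fun D (fun y : R => (y ^+ k.+1)%:E).
  by apply/measurable_EFinP; exact: exprn_measurable.
have X0 y : D y -> (0 <= (y ^+ k.+1)%:E)%E.
  by rewrite /D/= in_itv/= lee_fin => /andP[y0 _]; rewrite exprn_ge0// ltW.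
rewrite /al /be /= !ge0_integral_measure_add//.
have := hmom k; rewrite !pos_neg.
move: (fin mu k) (fin nu k) (fin (image_measure mu _ mopp) k)
  (fin (image_measure nu _ mopp) k) => /fineK<- /fineK<- /fineK<- /fineK<-.
by rewrite -!EFinB -!EFinD => -[e]; congr (_%:E); lra.
Qed.

(** * Recovering a law from its odd part *)

(** The numbers [y] with [`|y|] in [B], for [B] a set of positive numbers, whose
    sign is not the one prescribed by [E], namely positive exactly when [`|y|] is
    in [E]. *)
Definition misaligned {R : realType} (E B : set R) : set R :=
  (B `\` E) `|` (-%R @^-1` (B `&` E)).

Lemma measurable_misaligned {R : realType} (E B : set R) :
  measurable E -> measurable B -> measurable (misaligned E B).
Proof.
move=> mE mB; apply: measurableU; first exact: measurableD.
rewrite -[X in measurable X]setTI; apply: oppr_measurable => //.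
exact: measurableI.
Qed.

(** Apply the equality of the odd parts to [B `&` E] and to [B `\` E]. As [mu] is
    aligned with [E], in each case one of its two terms vanishes and the other
    is all that [mu] has there; adding up, [mu] sees on [B] the aligned mass of
    [nu] minus the misaligned one, whereas the total mass of [nu] is their
    sum. *)
Lemma sign_rigidity {R : realType} (E : set R)
    (mu nu : {finite_measure set (measurableTypeR R) -> \bar R}) :
  measurable E -> mu (misaligned E `]0, 1]) = 0%E ->
  (forall A : set R, measurable A -> A `<=` `]0%R, 1%R] ->
    mu A + nu (-%R @^-1` A) = nu A + mu (-%R @^-1` A))%E ->
  forall B : set R, measurable B -> B `<=` `]0, 1] ->
  (mu (Num.norm @^-1` B) + nu (misaligned E B) + nu (misaligned E B) =
   nu (Num.norm @^-1` B))%E.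
Proof.
move=> mE mu0 hodd B mB B01.
have mN (A : set R) : measurable A -> measurable (-%R @^-1` A : set R).
  by move=> mA; rewrite -[X in measurable X]setTI; exact: oppr_measurable.
have mBE : measurable (B `&` E) by exact: measurableI.
have mBCE : measurable (B `\` E) by exact: measurableD.
have B0 y : B y -> 0 < y by move=> /B01/=; rewrite in_itv/= => /andP[].
have normB : Num.norm @^-1` B = B `|` -%R @^-1` B.
  apply/seteqP; split => y /=.
    by have [y0|y0] := ger0P y; [left|right].
  by move=> [By|By]; [rewrite gtr0_norm//|rewrite ltr0_norm// -oppr_gt0]; exact: B0.
have splitN (la : {finite_measure set (measurableTypeR R) -> \bar R}) (A A' : set R) :
    measurable A -> measurable A' -> A `<=` B -> A' `<=` B ->
    la (A `|` -%R @^-1` A') = (la A + la (-%R @^-1` A'))%E.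
  move=> mA mA' AB A'B; rewrite measureU//; first exact: mN.
  apply/seteqP; split => // y [/AB/B0 y0 /A'B/B0 /=]; rewrite oppr_gt0; lra.
have splitE (la : {finite_measure set (measurableTypeR R) -> \bar R}) (h : R -> R) :
    (forall A : set R, measurable A -> measurable (h @^-1` A)) ->
    la (h @^-1` B) = (la (h @^-1` (B `&` E)) + la (h @^-1` (B `\` E)))%E.
  move=> mh; rewrite -measureU; [|exact: mh|exact: mh|].
    by rewrite -preimage_setU setUIDK.
  by apply/seteqP; split => // y [[_ yE] [_ /(_ yE)]].
have mu0B (A : set R) : measurable A -> A `<=` misaligned E B -> mu A = 0%E.
  move=> mA AB; apply: (subset_measure0 (mu := mu) mA _ _ mu0).
    by apply: measurable_misaligned => //; exact: measurable_itv.
  apply: subset_trans AB _ => y [[By nE]|[By Ey]]; [left|right]; split => //; exact: B01.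
have h1 := hodd _ mBE (subset_trans (@subIsetl _ _ _) B01).
have h2 := hodd _ mBCE (subset_trans (@subDsetl _ _ _) B01).
have muI : mu (-%R @^-1` (B `&` E)) = 0%E.
  by apply: mu0B; [exact: mN|move=> y; right].
have muD : mu (B `\` E) = 0%E by apply: mu0B => // y; left.
have sD : B `\` E `<=` B by exact: subDsetl.
have sI : B `&` E `<=` B by exact: subIsetl.
rewrite normB /misaligned !splitN//.
rewrite !(splitE _ id)// !(splitE _ -%R)//.
have fE (la : {finite_measure set (measurableTypeR R) -> \bar R}) (A : set R) :
  measurable A -> la A = (fine (la A))%:E by move=> mA; rewrite fineK// fin_num_measure.
rewrite !preimage_id /= muI muD in h1 h2 *.
move: h1 h2.
rewrite (fE mu _ mBE) (fE nu _ mBE) (fE nu _ (mN _ mBE)).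
rewrite (fE nu _ mBCE) (fE mu _ (mN _ mBCE)) (fE nu _ (mN _ mBCE)) -!EFinD.
by move=> [h1] [h2]; congr (_%:E); lra.
Qed.

Lemma exp_measure_ray {R : realType} (s0 : \bar R) (s0gt : (-oo < s0)%E) (A A' : set R) :
  A `&` ray s0 = A' `&` ray s0 -> exp_measure s0gt A = exp_measure s0gt A'.
Proof. by rewrite /exp_measure => ->. Qed.

(** Two initial segments are comparable for inclusion, so if they have the same
    finite mass then their difference is null in either direction. *)
Lemma initial_segments_null {R : realType} (s0 : \bar R) (s0gt : (-oo < s0)%E)
    (A A' : set R) :
  measurable A -> measurable A' ->
  (forall s t, A t -> ray s0 s -> s <= t -> A s) ->
  (forall s t, A' t -> ray s0 s -> s <= t -> A' s) ->
  exp_measure s0gt A = exp_measure s0gt A' ->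
  lebesgue_measure ((A `\` A') `&` ray s0) = 0%E.
Proof.
move=> mA mA' dA dA' e.
have [sub|nsub] := pselect (A `&` ray s0 `<=` A').
  rewrite (_ : _ `&` _ = set0) ?measure0//; apply/seteqP; split => // s.
  by move=> [[As nA's] sr]; apply: nA's; exact: sub.
apply/(exp_measure_null _ s0gt); first exact: measurableD.
have sub' : A' `&` ray s0 `<=` A.
  move=> t [A't tr]; apply: contrapT => nAt; apply: nsub => s [As sr].
  have [st|/ltW ts] := leP s t; first exact: dA' st.
  by case: nAt; exact: dA ts.
have mr := measurable_ray s0.
have -> : exp_measure s0gt (A `\` A') = exp_measure s0gt (A `\` (A' `&` ray s0)).
  apply: exp_measure_ray; apply/seteqP; split => s [[As nA's] sr];
    split => //; split => //.
    by move=> [].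
  by move=> A's; exact: nA's.
pose mu : {finite_measure set (measurableTypeR R) -> \bar R} := exp_measure s0gt.
have mI : measurable (A' `&` ray s0) by exact: measurableI.
have mufin : (mu A < +oo)%E by rewrite -ge0_fin_numE// fin_num_measure.
have := measureD (mu := mu) mA mI mufin; rewrite (setIidr sub').
rewrite /mu /= => ->; rewrite e (exp_measure_ray s0 s0gt (A' `&` _) A') ?subee//.
  exact: (fin_num_measure mu).
by rewrite -setIA setIid.
Qed.

(** * Laws of representations and uniqueness *)
Section law.
Context {R : realType} {f : R -> R} {s0 : \bar R} {g : R -> R}.
Hypothesis rep : exp_representation f s0 g.

Let s0gt : (-oo < s0)%E. Proof. by case: rep. Qed.

Let g0 : measurableTypeR R -> measurableTypeR R := g \_ (ray s0).

Let mg0 : measurable_fun setT g0.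
Proof.
by case: rep => _ mg _ _ _; apply/(measurable_restrictT _ (measurable_ray s0)).
Qed.

(** The distribution of [g] under [expR (- s) ds]. Extending [g] by [0] outside
    the ray makes it measurable everywhere, without changing the distribution
    because the measure lives on the ray. *)
Definition law : {finite_measure set (measurableTypeR R) -> \bar R} :=
  image_measure (exp_measure s0gt) g0 mg0.

Lemma lawE A : law A = exp_measure s0gt (g @^-1` A).
Proof.
apply: exp_measure_ray; apply/seteqP; split => s [] /=;
  by rewrite /g0 patchE => + sr; rewrite mem_set.
Qed.

Lemma bracket_law z : 0 < z ->
  (f z)%:E = (\int[law]_(y in `[(-1)%R, 1%R]) (bracket y z)%:E)%E.
Proof.
move=> z0; have [_ mg g1 _ fE] := rep.
have g01 s : -1 <= g0 s <= 1.
  rewrite /g0 patchE; case: ifPn => [/set_mem/g1[]//|_].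
  by rewrite lerN10 ler01.
have mb : measurable_fun setT (fun s => bracket (g0 s) z).
  exact: measurable_bracket.
have b1 s : `|bracket (g0 s) z| <= 1 by exact: bracket_le1.
have pre : g0 @^-1` `[-1, 1] = setT.
  by apply/seteqP; split => // s _; rewrite /= in_itv/=.
rewrite /law /image_measure integral_pushforward//=.
- rewrite pre fE// integral_exp_measure//.
  by apply: eq_integral => s sr; rewrite /g0 patchE sr.
- apply/measurable_EFinP; exact: (measurable_bracket setT id).
- rewrite pre; apply: measurable_bounded_integrable => //.
  + by rewrite -ge0_fin_numE// (fin_num_measure (exp_measure s0gt)).
  + by exists 1; split => // M M1 s _; exact: le_trans (b1 s) (ltW M1).
Qed.

End law.
Arguments law {R f s0 g} rep.

Lemma law_norm {R : realType} {f : R -> R} {s0 : \bar R} {g : R -> R}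
    (rep : exp_representation f s0 g) (s0gt : (-oo < s0)%E) (B : set R) :
  law rep (Num.norm @^-1` B) = exp_measure s0gt [set s | B `|g s|].
Proof. exact: lawE. Qed.

Lemma law_misaligned {R : realType} {f : R -> R} {s0 : \bar R} {g : R -> R}
    (rep : exp_representation f s0 g) :
  exists2 E : set R, measurable E & law rep (misaligned E `]0, 1]) = 0%E.
Proof.
have [s0gt mg g1 ng _] := rep.
have [E mE hE] := nested_on_measurable_sign _ _ mg ng; exists E => //.
rewrite lawE (exp_measure_ray _ _ _ set0) ?measure0//.
rewrite set0I; apply/seteqP; split => // s [] /= + sr.
have := hE s sr; move=> hEs [[]|[]] /=; rewrite in_itv/=.
  by move=> /andP[gs0 _] nE; apply: nE; rewrite -(gtr0_norm gs0); apply/hEs.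
rewrite oppr_gt0 => /andP[gs0 _]; rewrite -(ltr0_norm gs0) => /hEs.
by move=> /(lt_trans gs0); rewrite ltxx.
Qed.

(** Rigidity applied in both directions bounds the masses of the two laws by each
    other, so that the misaligned mass, which is the difference, vanishes. *)
Lemma law_rigidity {R : realType} {f : R -> R} {s0 s0' : \bar R} {g g' : R -> R}
    (rep : exp_representation f s0 g) (rep' : exp_representation f s0' g')
    (E : set R) : measurable E -> law rep (misaligned E `]0, 1]) = 0%E ->
  law rep' (misaligned E `]0, 1]) = 0%E /\
  forall B : set R, measurable B -> B `<=` `]0, 1] ->
    law rep (Num.norm @^-1` B) = law rep' (Num.norm @^-1` B).
Proof.
move=> mE E0.
have [E' mE' E'0] := law_misaligned rep'.
have hmom (k : nat) := esym (bracket_law rep _ (ltr0Sn R k)).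
have hmom' (k : nat) := esym (bracket_law rep' _ (ltr0Sn R k)).
have odd A mA A01 := odd_moment_unique (law rep) (law rep')
  (fun k => etrans (hmom k) (esym (hmom' k))) A mA A01.
have H := sign_rigidity E _ _ mE E0 odd.
have H' := sign_rigidity E' _ _ mE' E'0
  (fun A mA A01 => esym (odd A mA A01)).
have le (B : set R) : measurable B -> B `<=` `]0, 1] ->
    (law rep (Num.norm @^-1` B) <= law rep' (Num.norm @^-1` B))%E.
  by move=> mB B01; rewrite -H// -addeA leeDl// adde_ge0.
have le' (B : set R) : measurable B -> B `<=` `]0, 1] ->
    (law rep' (Num.norm @^-1` B) <= law rep (Num.norm @^-1` B))%E.
  by move=> mB B01; rewrite -H'// -addeA leeDl// adde_ge0.
split; last by move=> B mB B01; apply/eqP; rewrite eq_le le ?le'.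
have m01 : measurable (`]0, 1]%classic : set R) by exact: measurable_itv.
have mm := measurable_misaligned E _ mE m01.
have mn : measurable (Num.norm @^-1` `]0, 1]%classic : set R).
  by rewrite -[X in measurable X]setTI; exact: normr_measurable.
have := le' _ m01 (fun _ => id); rewrite -(H _ m01 (fun _ => id)).
rewrite -(fineK (fin_num_measure (law rep) _ mn)).
rewrite -(fineK (fin_num_measure (law rep') _ mm)) -!EFinD lee_fin => h.
have : 0 <= fine (law rep' (misaligned E `]0, 1])) by exact: fine_ge0.
by move=> h0; congr (_%:E); lra.
Qed.

(** The starting point is read off from the total mass [expR (- s0)]. *)
Lemma exp_representation_start {R : realType} {f : R -> R} {s0 s0' : \bar R}
    {g g' : R -> R} :
  exp_representation f s0 g -> exp_representation f s0' g' -> s0' = s0.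
Proof.
move=> rep rep'; have [E mE E0] := law_misaligned rep.
have [_ /(_ `]0, 1]%classic)] := law_rigidity rep rep' E mE E0.
move=> /(_ (measurable_itv _) (fun _ => id)).
have total (s1 : \bar R) (g1 : R -> R) (r : exp_representation f s1 g1)
    (gt : (-oo < s1)%E) :
    law r (Num.norm @^-1` `]0, 1]) = (if s1 is t%:E then expR (- t) else 0)%:E.
  rewrite (law_norm r gt) -(exp_measure_setT _ gt).
  apply: exp_measure_ray; apply/seteqP; split => s [] //= _ sr; split => //.
  have [_ _ /(_ s sr)[g11 gn0] _ _] := r.
  by rewrite in_itv/= normr_gt0 gn0 ler_norml.
have [gt _ _ _ _] := rep; have [gt' _ _ _ _] := rep'.
rewrite (total _ _ rep gt) (total _ _ rep' gt') => -[].
case: s0 s0' gt gt' {rep rep' E0 total} => [r| |] [r'| |]//= _ _.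
- by move=> /expR_inj/oppr_inj ->.
- by have := expR_gt0 (- r) => /[swap] ->; rewrite ltxx.
- by have := expR_gt0 (- r') => /[swap] <-; rewrite ltxx.
Qed.

Lemma law_aligned {R : realType} {f : R -> R} {s0 : \bar R} {g : R -> R}
    (rep : exp_representation f s0 g) (E : set R) : measurable E ->
  law rep (misaligned E `]0, 1]) = 0%E ->
  {ae @lebesgue_measure R, forall s, ray s0 s -> E `|g s| <-> 0 < g s}.
Proof.
move=> mE E0; have [s0gt mg g1 _ _] := rep.
have m01 : measurable (`]0, 1]%classic : set R) by exact: measurable_itv.
have mr := measurable_ray s0.
pose Z := ray s0 `&` g @^-1` misaligned E `]0, 1].
have mZ : measurable Z by apply: mg => //; exact: measurable_misaligned.
exists Z; split => //.
  have ZE : Z `&` ray s0 = Z by rewrite /Z setIAC setIid.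
  rewrite -ZE; apply/(exp_measure_null _ s0gt) => //.
  rewrite -E0 lawE; apply: exp_measure_ray.
  by rewrite ZE /Z setIC.
move=> s /= h; apply: contrapT => hN; apply: h => sr.
have [] := g1 s sr; rewrite -ler_norml => g11 gn0.
split => [Eg|gs0].
  rewrite lt0r gn0/= leNgt; apply/negP => gs0; apply: hN; split => //; right.
  by rewrite /= -(ltr0_norm gs0) in_itv/= normr_gt0 gn0 g11.
apply: contrapT => nE; apply: hN; split => //; left; rewrite -(gtr0_norm gs0).
by rewrite /= in_itv/= normr_gt0 gn0 g11.
Qed.

(** The sets [q <= `|g s|] and [q <= `|g' s|] are initial segments of the ray of
    the same mass; for rational [q] they coincide outside one common null set, on
    whose complement the absolute values are equal. The signs are then both
    given by [E]. *)
Lemma exp_representation_unique {R : realType} {f : R -> R} {s0 : \bar R}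
    {g g' : R -> R} :
  exp_representation f s0 g -> exp_representation f s0 g' ->
  {ae @lebesgue_measure R, forall s : R, ray s0 s -> g' s = g s}.
Proof.
move=> rep rep'; have [E mE E0] := law_misaligned rep.
have [E0' eqB] := law_rigidity rep rep' E mE E0.
have [s0gt mg g1 ng _] := rep; have [_ mg' g1' ng' _] := rep'.
have mr := measurable_ray s0.
pose level (h : R -> R) (q : R) := ray s0 `&` [set s | q <= `|h s|].
have mlevel h q : measurable_fun (ray s0) h -> measurable (level h q).
  move=> mh.
  have -> : level h q = ray s0 `&` (Num.norm \o h) @^-1` `[q, +oo[.
    by apply/seteqP; split => s [sr hs]; split => //; move: hs;
      rewrite /= in_itv/= andbT.
  by apply: (measurableT_comp (@normr_measurable R setT) mh) => //.
have mass q : 0 < q -> exp_measure s0gt (level g q) = exp_measure s0gt (level g' q).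
  move=> q0; have := eqB `[q, 1]%classic (measurable_itv _).
  rewrite !(law_norm _ s0gt) => h.
  have lv (h' : R -> R) : (forall s, ray s0 s -> -1 <= h' s <= 1 /\ h' s != 0) ->
      exp_measure s0gt (level h' q) = exp_measure s0gt [set s | `[q, 1]%classic `|h' s|].
    move=> h1; apply: exp_measure_ray; apply/seteqP.
    split => s [] /=; rewrite ?in_itv/=.
      by move=> [sr ->] _; rewrite ler_norml; have [-> _] := h1 s sr.
    by move=> /andP[qs _] sr.
  rewrite !lv//; apply: h => y /=; rewrite !in_itv/= => /andP[qy ->].
  by rewrite (lt_le_trans q0).
have down h q : nested_on (ray s0) h ->
    forall s t, level h q t -> ray s0 s -> s <= t -> level h q s.
  move=> nh s t [tr qt] sr st; split => //=.
  exact: le_trans qt (nested_on_norm _ _ nh _ _ sr tr st).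
have null q : 0 < q ->
    lebesgue_measure ((level g q `\` level g' q) `&` ray s0) = 0%E /\
    lebesgue_measure ((level g' q `\` level g q) `&` ray s0) = 0%E.
  move=> q0; split; apply: (initial_segments_null _ s0gt); rewrite ?mass//;
    by [exact: mlevel|exact: down].
have eqlevel (r : rat) : {ae @lebesgue_measure R, forall s, ray s0 s ->
    0 < (ratr r : R) -> (ratr r <= `|g s|) = (ratr r <= `|g' s|)}.
  have [r0|r0] := leP (ratr r : R) 0.
    by apply: aeW.
  have [n1 n2] := null _ r0; set q : R := ratr r in r0 n1 n2 *.
  exists (((level g q `\` level g' q) `&` ray s0) `|`
          ((level g' q `\` level g q) `&` ray s0)); split.
  - by apply: measurableU; apply: measurableI => //; apply: measurableD; exact: mlevel.
  - rewrite measureU0//; by apply: measurableI => //; apply: measurableD; exact: mlevel.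
  - move=> s /= h; apply: contrapT => hN; apply: h => sr _.
    apply/idP/idP => hq; apply: contrapT => nq; apply: hN; [left|right];
      by split => //; split => // -[].
have /ae_foralln eqlevels n := eqlevel (odflt 0 (unpickle n)).
apply: filterS3 eqlevels (law_aligned rep E mE E0) (law_aligned rep' E mE E0').
move=> s eqs sg sg' sr.
have noLt (h h' : R -> R) : (forall r : rat, 0 < (ratr r : R) ->
    (ratr r <= `|h s|) = (ratr r <= `|h' s|)) -> `|h s| <= `|h' s|.
  move=> hh; rewrite leNgt; apply/negP => lt.
  have [r] := rat_in_itvoo lt; rewrite in_itv/= => /andP[rh hr].
  have := hh r (le_lt_trans (normr_ge0 _) rh).
  by rewrite (ltW hr) leNgt rh.
have eqr (r : rat) : 0 < (ratr r : R) -> (ratr r <= `|g s|) = (ratr r <= `|g' s|).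
  by have := eqs (pickle r) sr; rewrite pickleK.
have eqn : `|g s| = `|g' s|.
  by apply/eqP; rewrite eq_le !noLt// => r r0; rewrite eqr.
have [_ gn0] := g1 s sr; have [_ gn0'] := g1' s sr.
move: (sg sr) (sg' sr); rewrite -eqn => sE sE'.
have [gs|gs] := ltP 0 (g s).
  by rewrite -(gtr0_norm gs) eqn gtr0_norm//; apply/sE'/sE.
have gs' : g' s <= 0 by rewrite leNgt; apply/negP => /sE'/sE; rewrite ltNge gs.
by apply: oppr_inj; rewrite -(ler0_norm gs) -(ler0_norm gs') eqn.
Qed.

Theorem theorem5p4 (R : realType) (f : R -> R) (hf : Bbp f) :
  exists (s0 : \bar R) (g : R -> R),
    exp_representation f s0 g /\
    forall (s0' : \bar R) (g' : R -> R),
      exp_representation f s0' g' ->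
      s0' = s0 /\
      {ae @lebesgue_measure R, forall s : R, ray s0 s -> g' s = g s}.
Proof.
have [s0 [g rep]] := exp_representation_exists f hf.
exists s0, g; split=> // s0' g' rep'.
have e := exp_representation_start rep rep'; split=> //.
by move: rep'; rewrite e; exact: exp_representation_unique.
Qed.
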